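(* If $f$ is a fertility number, then there are arbitrarily long permutations with fertility $f$; that is, for every positive integer $N$ there is a permutation $\pi$ of length at least $N$ with $|s^{-1}(\pi)|=f$.
   Context: A permutation is a permutation of a finite set of positive integers, written as a word in one-line notation (a word with distinct entries); its length is its number of entries. $S_n$ denotes the set of permutations of $\{1,\ldots,n\}$. West's stack-sorting map $s$ is defined recursively: $s$ sends the empty permutation to the empty permutation, and if $\pi$ is a nonempty permutation with largest entry $m$, write $\pi=LmR$, where $L$ and $R$ are the (possibly empty) substrings of $\pi$ to the left and right of $m$; then $s(\pi)=s(L)s(R)m$. The fertility of a permutation $\pi$ is $|s^{-1}(\pi)|$, the number of preimages of $\pi$ under $s$. A nonnegative integer $f$ is a fertility number if there exists a permutation with fertility $f$. *)

(* Defs.v *)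
From mathcomp Require Import all_boot.
From mathcomp Require Import classical_sets cardinality.

Set Implicit Arguments.
Unset Strict Implicit.
Unset Printing Implicit Defensive.

Local Open Scope classical_set_scope.

Definition is_permutation (w : seq nat) : bool := uniq w && all (leq 1) w.

Definition max_entry (w : seq nat) : nat := foldr maxn 0 w.
Definition left_of_max (w : seq nat) : seq nat := take (index (max_entry w) w) w.
Definition right_of_max (w : seq nat) : seq nat :=
  drop (index (max_entry w) w).+1 w.

(* The first argument only bounds the recursion depth; [stack_sortE] below is *)
(* the recursive description of the map, free of this bound.                  *)
Fixpoint stack_sort_rec (fuel : nat) (w : seq nat) : seq nat :=
  if fuel is k.+1 then
    if w is [::] then [::] else
    stack_sort_rec k (left_of_max w) ++ stack_sort_rec k (right_of_max w)
      ++ [:: max_entry w]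
  else [::].

Definition stack_sort (w : seq nat) : seq nat := stack_sort_rec (size w) w.

Lemma max_entry_in (w : seq nat) : w != [::] -> max_entry w \in w.
Proof.
elim: w => // x [|y w] IHw _; first by rewrite /max_entry /= maxn0 mem_head.
rewrite inE [max_entry _]/(maxn x (max_entry (y :: w))) /maxn.
by case: ifP => _; rewrite ?eqxx // IHw ?orbT.
Qed.

Lemma left_of_max_size (w : seq nat) :
  w != [::] -> size (left_of_max w) < size w.
Proof. by move=> /max_entry_in w_m; rewrite size_take index_mem w_m index_mem. Qed.

Lemma right_of_max_size (w : seq nat) :
  w != [::] -> size (right_of_max w) < size w.
Proof. by case: w => // x w _; rewrite size_drop /= subSS ltnS leq_subr. Qed.

Lemma max_decomposition (w : seq nat) :
  w != [::] -> w = left_of_max w ++ max_entry w :: right_of_max w.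
Proof.
move=> /max_entry_in w_m; rewrite /left_of_max /right_of_max.
rewrite -[LHS](cat_take_drop (index (max_entry w) w)).
by rewrite (drop_nth 0) ?index_mem // nth_index.
Qed.

Lemma stack_sort_rec_size (k : nat) (w : seq nat) :
  size w <= k -> stack_sort_rec k w = stack_sort w.
Proof.
rewrite /stack_sort.
have [n] := ubnP (size w); elim: n => // n IHn in k w *.
case: w k => [|x w] [|k] // lt_n le_k.
set v := x :: w in lt_n le_k *.
have ltl : size (left_of_max v) <= size w by apply: (@left_of_max_size v).
have ltr : size (right_of_max v) <= size w by apply: (@right_of_max_size v).
have bnd m : m <= size w -> m < n by move=> le_m; apply: leq_ltn_trans le_m _.
rewrite /= -/v (IHn k) ?(IHn k (right_of_max v)) ?bnd //;
  try by [rewrite (leq_trans ltl) | rewrite (leq_trans ltr)].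
by rewrite (IHn (size w)) ?(IHn (size w) (right_of_max v)) ?bnd.
Qed.

Lemma stack_sort_nil : stack_sort [::] = [::].
Proof. by []. Qed.

Lemma stack_sortE (w : seq nat) : w != [::] ->
  stack_sort w =
    stack_sort (left_of_max w) ++ stack_sort (right_of_max w)
      ++ [:: max_entry w].
Proof.
case: w => // x w w0; rewrite {1}/stack_sort /=.
by rewrite !stack_sort_rec_size // -ltnS ?left_of_max_size ?right_of_max_size.
Qed.

Definition stack_preimage (w : seq nat) : set (seq nat) :=
  [set v | is_permutation v /\ stack_sort v = w].

Definition has_fertility (w : seq nat) (f : nat) : Prop :=
  (stack_preimage w #= `I_f)%card.

Definition fertility_number (f : nat) : Prop :=
  exists w : seq nat, is_permutation w /\ has_fertility w f.

(* Main.v *)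
Require Import Defs.
From mathcomp Require Import all_boot.
From mathcomp Require Import classical_sets cardinality.

(** If [w] is nonempty, raise every entry of [w] by one and append first the
    entry 1, now unused and smaller than everything else, and then a new
    maximum [m].  The resulting word [lengthen w] has exactly as many
    preimages as [w].  Indeed a preimage has the form [L m R], and
    [s(L) s(R)] is the raised copy of [w] followed by 1.  The image under [s]
    of a nonempty word ends in its maximum, so [R] cannot be empty (the last
    entry 1 of [s(L)] would dominate the raised entries), and [s(R)], which
    ends in 1, cannot reach into the raised copy of [w].  Hence [R = 1] and
    [s(L)] is the raised copy of [w].  As [s] depends only on the relative
    order of the entries, such [L] are the raised copies of the preimages of
    [w] ([stack_preimage_lengthen]).  Iterating this construction gives
    arbitrarily long permutations of the same fertility; the empty word, to
    which it does not apply, is first replaced by the word 1, both having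
    fertility one. *)

Set Implicit Arguments.
Unset Strict Implicit.
Unset Printing Implicit Defensive.

Local Open Scope classical_set_scope.

Lemma leq_max_entry w x : x \in w -> x <= max_entry w.
Proof.
elim: w => // y w IHw; rewrite inE /max_entry /= -/(max_entry w) leq_max.
by case/orP=> [/eqP->|/IHw->]; rewrite ?leqnn ?orbT.
Qed.

Lemma max_entry_unique w m :
  m \in w -> {in w, forall x, x <= m} -> max_entry w = m.
Proof.
move=> w_m le_m; apply/eqP; rewrite eqn_leq leq_max_entry // andbT le_m //.
by apply: max_entry_in; case: w w_m {le_m}.
Qed.

(** Strictness on the left makes the displayed [m] the first occurrence of the
    maximum, which is the one that the map looks up. *)
Lemma stack_sort_cat_max L m R :
  {in L, forall x, x < m} -> {in R, forall x, x <= m} ->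
  stack_sort (L ++ m :: R) = stack_sort L ++ stack_sort R ++ [:: m].
Proof.
move=> ltL leR.
have maxE : max_entry (L ++ m :: R) = m.
  apply: max_entry_unique => [|x]; first by rewrite mem_cat mem_head orbT.
  by rewrite mem_cat inE => /or3P[/ltL/ltnW|/eqP->|/leR].
have idxE : index m (L ++ m :: R) = size L.
  rewrite index_cat ifN /= ?eqxx ?addn0 //.
  by apply/negP => /ltL; rewrite ltnn.
rewrite stack_sortE; last by case: (L).
rewrite /left_of_max /right_of_max maxE idxE take_size_cat //.
by rewrite drop_cat ltnNge leqnSn /= subSn // subnn /= drop0.
Qed.

Lemma perm_stack_sort w : perm_eq (stack_sort w) w.
Proof.
have [n] := ubnP (size w); elim: n => // n IHn in w *.
have [->//|w0] := eqVneq w [::]; rewrite ltnS => le_n.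
rewrite stack_sortE // [X in perm_eq _ X]max_decomposition // perm_cat //.
  by apply: IHn; apply: leq_trans (left_of_max_size w0) _.
rewrite cats1 perm_rcons perm_cons.
by apply: IHn; apply: leq_trans (right_of_max_size w0) _.
Qed.

Lemma mem_stack_sort w : stack_sort w =i w.
Proof. exact: perm_mem (perm_stack_sort w). Qed.

Lemma leq_last_stack_sort w u x : stack_sort w = rcons u x ->
  {in w, forall y, y <= x}.
Proof.
have [->|w0] := eqVneq w [::]; first by case: u.
rewrite stack_sortE // catA cats1 => /rcons_inj[_ <-] y.
exact: leq_max_entry.
Qed.

Lemma max_decomposition_uniq w : uniq w -> w != [::] ->
  exists L m R, [/\ w = L ++ m :: R, {in L, forall x, x < m}
                  & {in R, forall x, x < m}].
Proof.
move=> Uw w0; exists (left_of_max w), (max_entry w), (right_of_max w).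
have defw := max_decomposition w0.
have le_m x : x \in w -> x <= max_entry w by apply: leq_max_entry.
move: (left_of_max w) (right_of_max w) (max_entry w) defw le_m => L R m defw.
move: Uw; rewrite defw cat_uniq /= negb_or => /and3P[_ /andP[L'm _]].
case/andP=> R'm _ le_m; split=> // x x_in; rewrite ltn_neqAle le_m.
- by rewrite andbT; apply: contraNneq L'm => <-.
- by rewrite mem_cat x_in.
- by rewrite andbT; apply: contraNneq R'm => <-.
- by rewrite mem_cat inE x_in !orbT.
Qed.

(** The map only compares entries, so it commutes with order-preserving
    relabelling. *)
Lemma stack_sort_map (g : nat -> nat) w : {homo g : x y / x < y} -> uniq w ->
  stack_sort (map g w) = map g (stack_sort w).
Proof.
move=> g_lt; have [n] := ubnP (size w); elim: n => // n IHn in w *.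
have [->//|w0 lt_n Uw] := eqVneq w [::].
have [L [m [R [defw ltL ltR]]]] := max_decomposition_uniq Uw w0.
move: Uw lt_n; rewrite defw size_cat /= addnS !ltnS => Uw le_n.
move: Uw; rewrite cat_uniq /= => /and4P[UL _ _ UR].
rewrite map_cat /= !stack_sort_cat_max //.
- rewrite !map_cat /= !IHn //.
  + by apply: leq_trans le_n; rewrite ltnS leq_addl.
  + by apply: leq_trans le_n; rewrite ltnS leq_addr.
- by move=> x /ltR/ltnW.
- by move=> _ /mapP[x /ltL /g_lt ? ->].
- by move=> _ /mapP[x /ltR /g_lt /ltnW ? ->].
Qed.

Definition lengthen (w : seq nat) : seq nat :=
  map succn w ++ [:: 1; (max_entry w).+2].

Definition lengthen_preimage (w v : seq nat) : seq nat :=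
  map succn v ++ [:: (max_entry w).+2; 1].

Lemma is_permutation_lengthen w : is_permutation w ->
  is_permutation (lengthen w).
Proof.
case/andP=> Uw pos; rewrite /is_permutation /lengthen all_cat cat_uniq /=.
rewrite map_inj_uniq ?Uw //=; last exact: succn_inj.
rewrite !andbT orbF negb_or; apply/andP; split; last first.
  by apply/allP=> _ /mapP[x _ ->].
apply/andP; split; apply/mapP=> -[x x_w] [].
  by move=> x0; move: (allP pos x x_w); rewrite -x0.
by move=> xE; have := leq_max_entry x_w; rewrite -xE ltnn.
Qed.

Lemma is_permutation_stack_sort v :
  is_permutation (stack_sort v) = is_permutation v.
Proof.
by rewrite /is_permutation (perm_uniq (perm_stack_sort v))
  (perm_all _ (perm_stack_sort v)).
Qed.

Lemma stack_sort_lengthen_preimage v : is_permutation v ->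
  stack_sort (lengthen_preimage (stack_sort v) v) = lengthen (stack_sort v).
Proof.
case/andP=> Uv _; rewrite /lengthen_preimage /lengthen stack_sort_cat_max.
- by rewrite stack_sort_map.
- move=> _ /mapP[x x_v ->].
  by rewrite !ltnS leq_max_entry // mem_stack_sort.
- by move=> x; rewrite inE => /eqP->.
Qed.

(** A letter below all the others can only come last in [s(L) s(R)] when it is
    the whole of [R], because a stack-sorted word ends in its maximum. *)
Lemma stack_sort_cat_eq_rcons a u L R :
  u != [::] -> {in u, forall x, a < x} ->
  stack_sort L ++ stack_sort R = rcons u a -> stack_sort L = u /\ R = [:: a].
Proof.
move=> u0 gt_a; case/lastP sR: (stack_sort R) => [|t y].
  rewrite cats0 => sL; case: u => // x u in u0 gt_a sL *.
  have: x <= a by rewrite (leq_last_stack_sort sL) // -mem_stack_sort sL mem_head.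
  by rewrite leqNgt gt_a ?mem_head.
rewrite -rcons_cat => /rcons_inj[def_u def_y]; rewrite {}def_y in sR.
have t0 : t = [::].
  case: t => // x t in def_u sR *.
  have: x <= a by rewrite (leq_last_stack_sort sR) // -mem_stack_sort sR mem_head.
  by rewrite leqNgt gt_a // -def_u mem_cat mem_head orbT.
rewrite t0 in sR def_u; split; first by rewrite -def_u cats0.
by apply/perm_small_eq; rewrite // perm_sym -[[:: a]]sR perm_stack_sort.
Qed.

Lemma lengthen_preimage_inj w : injective (lengthen_preimage w).
Proof.
move=> v1 v2; rewrite /lengthen_preimage -!cat_rcons !cats0.
by move=> /rcons_inj[/rcons_inj[eq_map]]; apply: inj_map succn_inj _ _ eq_map.
Qed.

Lemma stack_sort_eq_lengthen w v : is_permutation w -> w != [::] ->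
  is_permutation v -> stack_sort v = lengthen w ->
  exists2 v', is_permutation v' /\ stack_sort v' = w
            & v = lengthen_preimage w v'.
Proof.
case/andP=> Uw pos_w w0 /andP[Uv _] sv.
have v0 : v != [::] by apply: contra_eq_neq sv => ->; case: (w) w0.
have [L [m [R [def_v ltL ltR]]]] := max_decomposition_uniq Uv v0.
move: sv; rewrite {1}def_v stack_sort_cat_max //; last by move=> x /ltR/ltnW.
rewrite /lengthen catA cats1 -(cat1s 1) catA cats1 cats1 => /rcons_inj[sLR def_m].
have [] := stack_sort_cat_eq_rcons _ _ sLR.
- by case: (w) w0.
- by move=> _ /mapP[x /(allP pos_w) x_gt0 ->].
move=> sL def_R.
have def_L : L = map succn (map predn L).
  rewrite -map_comp -[LHS]map_id; apply/eq_in_map => x /=.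
  by rewrite -mem_stack_sort sL => /mapP[y _ ->].
have UL : uniq (map predn L).
  rewrite -(map_inj_uniq succn_inj) -def_L.
  by move: Uv; rewrite def_v cat_uniq => /and3P[].
have sL' : stack_sort (map predn L) = w.
  by apply: (inj_map succn_inj); rewrite -stack_sort_map // -def_L //.
exists (map predn L); last by rewrite def_v def_R def_m {1}def_L.
by split=> //; rewrite -is_permutation_stack_sort sL' /is_permutation Uw.
Qed.

Lemma stack_preimage_lengthen w : is_permutation w -> w != [::] ->
  stack_preimage (lengthen w) = lengthen_preimage w @` stack_preimage w.
Proof.
move=> w_perm w0; apply/seteqP; split=> [v [v_perm sv]|_ [v [v_perm sv] <-]].
  have [v' v'_w ->] := stack_sort_eq_lengthen w_perm w0 v_perm sv.
  by exists v'.
have sv' : stack_sort (lengthen_preimage w v) = lengthen w.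
  by rewrite -sv stack_sort_lengthen_preimage.
by split=> //; rewrite -is_permutation_stack_sort sv' is_permutation_lengthen.
Qed.

Lemma has_fertility_lengthen w f : is_permutation w -> w != [::] ->
  has_fertility w f -> has_fertility (lengthen w) f.
Proof.
move=> w_perm w0; apply: card_eq_trans; rewrite stack_preimage_lengthen //.
by apply: inj_card_eq => v1 v2 _ _; apply: lengthen_preimage_inj.
Qed.

Lemma stack_preimage_small w :
  is_permutation w -> size w <= 1 -> stack_preimage w = [set w].
Proof.
move=> w_perm w1; apply/seteqP; split=> [v [_ sv]|_ ->] /=.
  by apply/perm_small_eq; rewrite // perm_sym -sv perm_stack_sort.
by split=> //; apply/perm_small_eq; rewrite // perm_stack_sort.
Qed.

Lemma fertility_number_nonempty f : fertility_number f ->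
  exists w, [/\ is_permutation w, w != [::] & has_fertility w f].
Proof.
case=> w [w_perm w_f]; have [w0|w0] := eqVneq w [::]; last by exists w.
exists [:: 1]; split=> //; apply: card_eq_trans w_f.
by rewrite w0 !stack_preimage_small // (card_eql card_set1) card_eq_sym card_set1.
Qed.

Theorem theorem3p2 (f : nat) (hf : fertility_number f) (N : nat) (hN : 0 < N) :
  exists w : seq nat,
    [/\ is_permutation w, N <= size w & has_fertility w f].
Proof.
case: N hN => // N _; elim: N => [|N [w [w_perm le_w w_f]]].
  have [w [w_perm w0 w_f]] := fertility_number_nonempty hf.
  by exists w; split=> //; case: (w) w0.
have w0 : w != [::] by case: (w) le_w.
exists (lengthen w); split; first exact: is_permutation_lengthen.
  by rewrite size_cat size_map addn2 ltnS ltnW.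
exact: has_fertility_lengthen.
Qed.
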